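(* Let $M=\mathbb R^n$. For every $z\in M$ and all linearly independent $P,Q\in\mathring T^{\mathsf{geo}}_{\delta_z}\mathscr P_2$, $$\mathsf{Sec}_{\delta_z}(P,Q)=0.$$
   Context: $W_2$ is the Kantorovich-Wasserstein metric on the space $\mathscr P_2(\mathbb R^n)$ of probability measures with finite second moment; $\delta_z$ is the Dirac measure at $z$. $\mathscr P_2(TM)_\mu$ is the set of probability measures $P$ on $TM=\mathbb R^n\times\mathbb R^n$ with first marginal $\mu$ and $|P|_\mu:=(\int|v|^2dP)^{1/2}<\infty$; $P_x$ is the disintegration, $dP(x,v)=dP_x(v)d\mu(x)$ (for $\mu=\delta_z$, $P$ is simply a probability measure on $T_zM=\mathbb R^n$). $tP$ is the push-forward of $P$ under $(x,v)\mapsto(x,tv)$ and $\exp(P)$ the push-forward under $(x,v)\mapsto x+v$. $$W_\mu(P,Q)=\inf\Big\{\int_M\int|v-w|^2\,dN_x(v,w)\,d\mu(x):\ N_x\in\mathrm{Cpl}(P_x,Q_x)\Big\}^{1/2},$$ where $\mathrm{Cpl}$ denotes couplings. $\mathring T^{\mathsf{geo}}_\mu\mathscr P_2$ is the set of $P\in\mathscr P_2(TM)_\mu$ for which there exist $C,t>0$ with $|v|\le C$ for $P$-a.e. $v$ and $W_2(\mu,\exp(tP))=t|P|_\mu$. $\langle P,Q\rangle_\mu=\frac12(|P|_\mu^2+|Q|_\mu^2-W_\mu^2(P,Q))$, $\Lambda_\mu(P,Q)=|P|_\mu^2|Q|_\mu^2-\langle P,Q\rangle_\mu^2$; $P,Q$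 are linearly independent if $W_\mu(P,Q)\notin\{|P|_\mu+|Q|_\mu,||P|_\mu-|Q|_\mu|\}$, i.e. $\Lambda_\mu(P,Q)>0$. $\mathsf{Sec}_\mu(P,Q)=L$ means that $\frac{3}{\Lambda_\mu(P,Q)s_j^2t_j^2}\big[W_\mu^2(s_jP,t_jQ)-W_2^2(\exp(s_jP),\exp(t_jQ))\big]\to L$ for every sequence in $(0,\infty)^2$ with $s_j,t_j\to0$ and $\sup_j(s_j/t_j+t_j/s_j)<\infty$. *)

(* Defs.v *)
From HB Require Import structures.
From mathcomp Require Import all_boot all_order all_algebra.
From mathcomp Require Import all_classical all_reals all_analysis.
From mathcomp Require Import measurable_realfun.
Set Implicit Arguments.
Unset Strict Implicit.
Unset Printing Implicit Defensive.
Import Order.TTheory GRing.Theory Num.Theory.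
Import numFieldNormedType.Exports.
Local Open Scope classical_set_scope.
Local Open Scope ring_scope.

(* R^n is 'rV[R]_n with the sigma-algebra generated by the n coordinates (the
   Borel sigma-algebra), as the library does for n.-tuple R.  The topological
   norm `|v| on 'rV[R]_n is the sup norm, so the Euclidean one is [enorm]. *)
Section measurable_rV.
Context {R : realType} {n : nat}.

Definition coord_rV (i : 'I_n) (x : 'rV[R]_n) : R := x ord0 i.

Let rV_set0 : g_sigma_preimage coord_rV set0.
Proof. exact: sigma_algebra0. Qed.

Let rV_setC A : g_sigma_preimage coord_rV A -> g_sigma_preimage coord_rV (~` A).
Proof. exact: sigma_algebraC. Qed.

Let rV_bigcup (F : (set 'rV[R]_n)^nat) :
  (forall i, g_sigma_preimage coord_rV (F i)) ->
  g_sigma_preimage coord_rV (\bigcup_i (F i)).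
Proof. exact: sigma_algebra_bigcup. Qed.

HB.instance Definition _ := @isMeasurable.Build
  (measure_tuple_display default_measure_display)
  'rV[R]_n (g_sigma_preimage coord_rV) rV_set0 rV_setC rV_bigcup.

Lemma measurable_coord_rV (i : 'I_n) : measurable_fun setT (coord_rV i).
Proof.
move=> _ Y mY; rewrite setTI; apply: sub_sigma_algebra => /=.
rewrite -bigcup_seq/=; exists i => /=; first by rewrite mem_index_enum.
by exists Y => //; rewrite setTI.
Qed.

End measurable_rV.

Lemma measurable_fun_rV (R : realType) (n : nat) d (T : measurableType d)
    (f : T -> 'rV[R]_n) :
  (forall i, measurable_fun setT (coord_rV i \o f)) -> measurable_fun setT f.
Proof.
move=> mf.
suff H : g_sigma_preimage (fun i => coord_rV i \o f) `<=` measurable.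
  move=> _ A mA; apply: H; rewrite g_sigma_preimage_comp.
  by exists A.
apply: smallest_sub; first exact: sigma_algebra_measurable.
case: n f mf => [|n] f mf; first by rewrite big_ord0.
rewrite -bigcup_mkord_ord; apply: bigcup_sub => i Ii.
by move=> A [B mB <-]; exact: mf.
Qed.

Section euclidean.
Context {R : realType} {n : nat}.

Definition sqnorm (v : 'rV[R]_n) : R := \sum_(i < n) v ord0 i ^+ 2.

Definition enorm (v : 'rV[R]_n) : R := Num.sqrt (sqnorm v).

End euclidean.

Definition coupling d1 d2 (T1 : measurableType d1) (T2 : measurableType d2)
    (R : realType) (mu : {measure set T1 -> \bar R})
    (nu : {measure set T2 -> \bar R})
    (pi : {measure set (T1 * T2) -> \bar R}) : Prop :=
  (forall A, measurable A -> pi (A `*` setT) = mu A) /\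
  (forall B, measurable B -> pi (setT `*` B) = nu B).

(* P(dx, dv) = k x (dv) mu(dx) *)
Definition disintegration d1 d2 (T1 : measurableType d1)
    (T2 : measurableType d2) (R : realType) (mu : probability T1 R)
    (P : probability (T1 * T2)%type R) (k : R.-pker T1 ~> T2) : Prop :=
  forall C, measurable C -> P C = (\int[mu]_x k x (xsection C x))%E.

Section transport.
Context {R : realType} {n : nat}.
Let M := 'rV[R]_n.
Let TM := ('rV[R]_n * 'rV[R]_n)%type.

Definition transport_cost (pi : {measure set TM -> \bar R}) : \bar R :=
  (\int[pi]_u (sqnorm (u.1 - u.2))%:E)%E.

(* [W2], [tnorm] and [Wmu] below are finite quantities when the measures have
   finite second moments (take a product coupling), so [fine] is harmless. *)
Definition W2 (mu nu : probability M R) : R :=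
  Num.sqrt (fine (ereal_inf
    [set c | exists pi : probability TM R,
       coupling mu nu pi /\ c = transport_cost pi])).

Definition tscale_map (t : R) (u : TM) : TM := (u.1, t *: u.2).

Definition texp_map (u : TM) : M := u.1 + u.2.

Let measurable_tscale_map t : measurable_fun setT (tscale_map t).
Proof.
apply: measurable_fun_pair => //; apply: measurable_fun_rV => i.
rewrite (_ : _ \o _ = (fun u : TM => t * coord_rV i u.2)); last first.
  by apply/funext => u /=; rewrite /coord_rV mxE.
apply: measurable_funM => //.
by apply: measurableT_comp => //; exact: measurable_coord_rV.
Qed.

HB.instance Definition _ t :=
  isMeasurableFun.Build _ _ _ _ (tscale_map t) (measurable_tscale_map t).

Let measurable_texp_map : measurable_fun setT texp_map.
Proof.
apply: measurable_fun_rV => i.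
rewrite (_ : _ \o _ = (fun u : TM => coord_rV i u.1 + coord_rV i u.2));
  last by apply/funext => u /=; rewrite /coord_rV mxE.
by apply: measurable_funD;
  apply: measurableT_comp => //; exact: measurable_coord_rV.
Qed.

HB.instance Definition _ :=
  isMeasurableFun.Build _ _ _ _ texp_map measurable_texp_map.

Definition tscale (t : R) (P : probability TM R) : probability TM R :=
  distribution P (tscale_map t).

Definition texp (P : probability TM R) : probability M R :=
  distribution P texp_map.

Definition tsqnorm (P : probability TM R) : \bar R :=
  (\int[P]_u (sqnorm u.2)%:E)%E.

Definition tnorm (P : probability TM R) : R := Num.sqrt (fine (tsqnorm P)).

Definition P2TM (mu : probability M R) (P : probability TM R) : Prop :=
  (forall A, measurable A -> P (A `*` setT) = mu A) /\ (tsqnorm P < +oo)%E.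

(* The disintegrations P_x, Q_x are determined up to mu-null sets only, so the
   infimum also ranges over their versions; N is a kernel, i.e. x |-> N_x is a
   measurable family of couplings. *)
Definition Wmu (mu : probability M R) (P Q : probability TM R) : R :=
  Num.sqrt (fine (ereal_inf
    [set c | exists (kP kQ : R.-pker M ~> M) (N : R.-pker M ~> TM),
       [/\ disintegration mu P kP, disintegration mu Q kQ,
           forall x, coupling (kP x) (kQ x) (N x)
         & c = (\int[mu]_x transport_cost (N x))%E]])).

Definition Tgeo (mu : probability M R) (P : probability TM R) : Prop :=
  P2TM mu P /\
  exists C t : R, [/\ 0 < C, 0 < t,
    {ae P, forall u, enorm u.2 <= C}
    & W2 mu (texp (tscale t P)) = t * tnorm P].

Definition tinner (mu : probability M R) (P Q : probability TM R) : R :=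
  2^-1 * (tnorm P ^+ 2 + tnorm Q ^+ 2 - Wmu mu P Q ^+ 2).

Definition Lambda (mu : probability M R) (P Q : probability TM R) : R :=
  tnorm P ^+ 2 * tnorm Q ^+ 2 - tinner mu P Q ^+ 2.

Definition lin_indep (mu : probability M R) (P Q : probability TM R) : Prop :=
  Wmu mu P Q <> tnorm P + tnorm Q /\ Wmu mu P Q <> `|tnorm P - tnorm Q|.

Definition Sec (mu : probability M R) (P Q : probability TM R) (L : R) : Prop :=
  forall s t : R^nat,
    (forall j, 0 < s j) -> (forall j, 0 < t j) ->
    s @ \oo --> (0 : R) -> t @ \oo --> (0 : R) ->
    (exists K : R, forall j, s j / t j + t j / s j <= K) ->
    (fun j => 3 / (Lambda mu P Q * s j ^+ 2 * t j ^+ 2) *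
       (Wmu mu (tscale (s j) P) (tscale (t j) Q) ^+ 2 -
        W2 (texp (tscale (s j) P)) (texp (tscale (t j) Q)) ^+ 2))
      @ \oo --> L.

End transport.

(* Main.v *)
From HB Require Import structures.
Require Import Defs.
From mathcomp Require Import all_boot all_order all_algebra.
From mathcomp Require Import all_classical all_reals all_analysis.
From mathcomp Require Import measurable_realfun.
Set Implicit Arguments.
Unset Strict Implicit.
Unset Printing Implicit Defensive.
Import Order.TTheory GRing.Theory Num.Theory.
Import numFieldNormedType.Exports.
Local Open Scope ring_scope.

(** Over a Dirac mass [\d_z] the tangent space is flat: a measure [P] on [TM]
    with first marginal [\d_z] is carried by the single fibre [{z} x R^n], where
    the exponential map is the translation [v |-> z + v].  Hence
    [(v, w) |-> (z + v, z + w)] transforms couplings of the fibre measures of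
    [P] and [Q] into couplings of [exp P] and [exp Q], its inverse transforms
    them back, and neither changes the quadratic cost.  The infima defining
    [Wmu \d_z P Q] and [W2 (exp P) (exp Q)] are thus taken over the same set of
    costs, so that the two distances agree ([Wmu_dirac]).  Dilations preserve
    the first marginal, so the difference quotient defining [Sec] is identically
    zero.

    In terms of kernels, an admissible family [N] of couplings enters only
    through its value at [z]; conversely, a coupling of [exp P] and [exp Q]
    provides a constant kernel. *)

Local Open Scope classical_set_scope.

Lemma eq_measure_on_full d (T : measurableType d) (R : realType)
    (P : probability T R) (Z C D : set T) :
  measurable Z -> measurable C -> measurable D -> P Z = 1%E ->
  C `&` Z = D `&` Z -> P C = P D.
Proof.
move=> mZ mC mD PZ CD.
have PZ0 : P (~` Z) = 0%E by rewrite probability_setC// PZ subee.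
have PE A : measurable A -> P A = P (A `&` Z).
  move=> mA; rewrite (measureDI P mA mZ) [X in (X + _)%E](_ : _ = 0%E) ?add0e//.
  apply: (@subset_measure0 _ _ _ P _ (~` Z)) => //; first exact: measurableD.
  exact: measurableC.
by rewrite (PE C)// (PE D)// CD.
Qed.

Section kernel_at.
Context d d' (X : measurableType d) (Y : measurableType d') (R : realType).
Variables (k : R.-pker X ~> Y) (x : X).

(** The value [k x] of a Markov kernel, as a probability measure: [W2] ranges
    over couplings of this type, whereas kernels take values in measures. *)
Definition kernel_at : set Y -> \bar R := k x.

HB.instance Definition _ := Measure.on kernel_at.

HB.instance Definition _ :=
  Measure_isProbability.Build _ _ _ kernel_at (prob_kernel x).

End kernel_at.

(** The kernel equal to the probability measure [P] at every point. *)
Definition constant_kernel d d' (X : measurableType d) (Y : measurableType d')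
    (R : realType) (P : probability Y R) : R.-pker X ~> Y :=
  kprobability (measurable_cst (P : pprobability Y R)).

Section euclidean_space.
Context {R : realType} {n : nat}.
Let M := 'rV[R]_n.
Let TM := ('rV[R]_n * 'rV[R]_n)%type.

Lemma measurable_set1_rV (z : M) : measurable [set z].
Proof.
rewrite (_ : [set z] = \big[setI/setT]_(i < n) (coord_rV i @^-1` [set z ord0 i])).
  apply: bigsetI_measurable => i _; rewrite -[X in measurable X]setTI.
  exact: measurable_coord_rV.
rewrite -bigcap_seq; apply/seteqP; split => [x -> i //|x h].
by apply/rowP => i; apply: (h i); rewrite /= mem_index_enum.
Qed.

Lemma sqnorm_ge0 (v : M) : 0 <= sqnorm v.
Proof. by apply: sumr_ge0 => i _; exact: sqr_ge0. Qed.

Lemma measurable_cost :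
  measurable_fun setT (fun u : TM => (sqnorm (u.1 - u.2))%:E).
Proof.
apply/measurable_EFinP; rewrite /sqnorm.
apply: measurable_sum => i; apply: measurable_funX.
rewrite (_ : (fun u : TM => _) =
    (fun u : TM => coord_rV i u.1 - coord_rV i u.2)); last first.
  by apply/funext => u /=; rewrite /coord_rV !mxE.
by apply: measurable_funB;
  apply: measurableT_comp => //; exact: measurable_coord_rV.
Qed.

Lemma measurable_translate (a : M) : measurable_fun setT (fun v : M => a + v).
Proof.
apply: measurable_fun_rV => i.
rewrite (_ : _ \o _ = (fun v : M => a ord0 i + coord_rV i v)).
  by apply: measurable_funD => //; exact: measurable_coord_rV.
by apply/funext => v /=; rewrite /coord_rV mxE.
Qed.

(** Diagonal translation: for [a = z] it is the exponential map at [z] on both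
    components of a pair of tangent vectors, and for [a = - z] its inverse. *)
Definition translate2 (a : M) (u : TM) : TM := (a + u.1, a + u.2).

Let measurable_translate2 a : measurable_fun setT (translate2 a).
Proof.
by apply: measurable_fun_pair; apply: measurableT_comp => //;
  exact: measurable_translate.
Qed.

HB.instance Definition _ a :=
  isMeasurableFun.Build _ _ _ _ (translate2 a) (measurable_translate2 a).

Lemma transport_cost_translate2 (a : M) (pi : probability TM R) :
  transport_cost (distribution pi (translate2 a)) = transport_cost pi.
Proof.
rewrite /transport_cost ge0_integral_distribution.
- by apply: eq_integral => u _ /=; rewrite opprD addrACA subrr add0r.
- exact: measurable_cost.
- by move=> u; rewrite lee_fin sqnorm_ge0.
Qed.

HB.instance Definition _ :=
  isMeasurableFun.Build _ _ TM M snd measurable_snd.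

Section dirac.
Variable z : M.
Let dz : probability M R := \d_z.

(** A measure over [\d_z] is carried by the fibre [{z} x R^n]. *)
Lemma dirac_marginalE (P : probability TM R) (C : set TM) :
  (forall A, measurable A -> P (A `*` setT) = dz A) -> measurable C ->
  P C = P (snd @^-1` xsection C z).
Proof.
move=> Pz mC; apply: (@eq_measure_on_full _ _ _ _ ([set z] `*` setT)) => //.
- by apply: measurableX => //; exact: measurable_set1_rV.
- rewrite -[X in measurable X]setTI; apply: measurable_snd => //.
  exact: measurable_xsection.
- by rewrite Pz; [rewrite /dz/= diracE mem_set|exact: measurable_set1_rV].
- apply/seteqP; split => -[x v] /= [] h [xz _]; split => //.
    by move: h; rewrite /xsection/= inE xz.
  by move: h; rewrite /xsection/= inE xz.
Qed.

(** Disintegrations over [\d_z] are constrained at [z] only, where they are the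
    law of the velocity. *)
Lemma disintegration_dirac (P : probability TM R) (k : R.-pker M ~> M) :
  (forall A, measurable A -> P (A `*` setT) = dz A) ->
  disintegration dz P k <->
  forall B, measurable B -> k z B = P (snd @^-1` B).
Proof.
move=> Pz.
have kE C : measurable C ->
    (\int[dz]_x k x (xsection C x) = k z (xsection C z))%E.
  move=> mC; rewrite integral_dirac ?diracT ?mul1e//.
  by apply: measurable_fun_xsection_finite_kernel; rewrite inE.
split => [Pk B mB|Pk C mC].
  have mTB : measurable (setT `*` B : set TM) by exact: measurableX.
  have xB : xsection (setT `*` B : set TM) z = B by rewrite in_xsectionX// inE.
  by rewrite -{1}xB -kE// -Pk// setTX.
rewrite kE// dirac_marginalE// Pk//; exact: measurable_xsection.
Qed.

(** [exp P] is the translate by [z] of the law of the velocity. *)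
Lemma texp_dirac (P : probability TM R) (A : set M) :
  (forall A, measurable A -> P (A `*` setT) = dz A) -> measurable A ->
  texp P A = P (snd @^-1` ((fun v => z + v) @^-1` A)).
Proof.
move=> Pz mA; rewrite [LHS]dirac_marginalE//.
  by congr (P _); apply/seteqP; split => -[x v]; rewrite /= /xsection/= inE.
exact: (measurable_funPTI (texp_map : {mfun TM >-> M})).
Qed.

Lemma Wmu_dirac (P Q : probability TM R) :
  (forall A, measurable A -> P (A `*` setT) = dz A) ->
  (forall A, measurable A -> Q (A `*` setT) = dz A) ->
  Wmu dz P Q = W2 (texp P) (texp Q).
Proof.
move=> Pz Qz; rewrite /Wmu /W2; congr (Num.sqrt (fine (ereal_inf _))).
have mtr (a : M) (A : set M) :
    measurable A -> measurable ((fun v => a + v) @^-1` A).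
  move=> mA; rewrite -[X in measurable X]setTI.
  by have := measurable_translate a; apply.
(* A family [N] of couplings yields the image of [N z] under translation by
   [z]; a coupling [pi] yields the constant family equal to its image under
   translation by [- z]. *)
apply/seteqP; split => [c [kP [kQ [N [dP dQ cN ->]]]]|c [pi [[piP piQ] ->]]].
  have [NP NQ] := cN z.
  exists (distribution (kernel_at N z) (translate2 z)); split; first split.
  - move=> A mA; rewrite [RHS]texp_dirac//.
    by rewrite -(disintegration_dirac kP Pz).1// -?NP//; exact: mtr.
  - move=> A mA; rewrite [RHS]texp_dirac//.
    by rewrite -(disintegration_dirac kQ Qz).1// -?NQ//; exact: mtr.
  rewrite transport_cost_translate2 integral_dirac ?diracT ?mul1e//.
  apply: measurable_fun_integral_kernel => //; last exact: measurable_cost.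
  - exact: measurable_kernel.
  - by move=> u; rewrite lee_fin sqnorm_ge0.
exists (constant_kernel M (distribution P snd)).
exists (constant_kernel M (distribution Q snd)).
exists (constant_kernel M (distribution pi (translate2 (- z)))).
split.
- exact/disintegration_dirac.
- exact/disintegration_dirac.
- move=> x; split => A mA.
  + rewrite -[LHS]/(pi ((fun v => - z + v) @^-1` A `*` setT)).
    rewrite piP; last exact: mtr.
    rewrite [LHS]texp_dirac//; last exact: mtr.
    by congr (P _); apply/seteqP; split => u /=; rewrite addKr.
  + rewrite -[LHS]/(pi (setT `*` (fun v => - z + v) @^-1` A)).
    rewrite piQ; last exact: mtr.
    rewrite [LHS]texp_dirac//; last exact: mtr.
    by congr (Q _); apply/seteqP; split => u /=; rewrite addKr.
- rewrite (eq_integral (cst (transport_cost pi))) => [|x _]; last first.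
    exact: (transport_cost_translate2 (- z) pi).
  by rewrite integral_dirac// diracT mul1e.
Qed.

End dirac.
End euclidean_space.

Theorem proposition3p23 (R : realType) (n : nat) (z : 'rV[R]_n)
    (P Q : probability ('rV[R]_n * 'rV[R]_n)%type R) :
  Tgeo (\d_z : probability 'rV[R]_n R) P ->
  Tgeo (\d_z : probability 'rV[R]_n R) Q ->
  lin_indep (\d_z : probability 'rV[R]_n R) P Q ->
  Sec (\d_z : probability 'rV[R]_n R) P Q 0.
Proof.
move=> [[Pz _] _] [[Qz _] _] _ s t _ _ _ _ _.
apply: cvg_near_cst; apply: nearW => j.
(* A dilation does not change the base point, so [Pz] and [Qz] are, by
   conversion, also the marginal conditions on the dilated measures. *)
by rewrite Wmu_dirac// subrr mulr0.
Qed.
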